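(* Let $N\ge 2$ and let $\mathcal{L}(u)=\prod_{j=1}^N (u-z_j)$ be a monic complex polynomial of degree $N$ all of whose zeros $z_1,\dots,z_N$ (listed with multiplicity) lie on the unit circle $|u|=1$. Let $\lambda_1,\dots,\lambda_N>0$ with $\sum_{j=1}^N\lambda_j=1$, and let $$\mathcal{L}_\lambda(u)=\sum_{j=1}^N \lambda_j\,\frac{\mathcal{L}(u)}{u-z_j}.$$ Let $z=e^{i\theta}$ and $z^{+}=e^{i\theta^{+}}$, with $\theta<\theta^{+}<\theta+2\pi$, be two consecutive distinct zeros of $\mathcal{L}$. Let $w_1,\dots,w_{N-1}$ be the zeros of $\mathcal{L}_\lambda$, counted with multiplicity. Then $$\sum_{k=1}^{N-1}\Theta(w_k;z,z^{+})=\pi+(N-2)\frac{\theta^{+}-\theta}{2},$$ where, if $w_k\in\{z,z^{+}\}$, the angle $\Theta(w_k;z,z^{+})$ is interpreted by the endpoint convention.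
   Context: For three distinct points $a,b,c\in\mathbb{C}$, $\Theta(a;b,c)\in[0,\pi]$ denotes the unoriented angle between the vectors $\overrightarrow{ab}$ and $\overrightarrow{ac}$ (the angle at the vertex $a$). Endpoint convention: for distinct points $z=e^{i\theta}$, $z^{+}=e^{i\theta^{+}}$ of the unit circle with $\theta<\theta^{+}<\theta+2\pi$, if $a\in\{z,z^{+}\}$ one sets $\Theta(a;z,z^{+}):=\frac{\theta^{+}-\theta}{2}$. Consecutive distinct zeros: $z=e^{i\theta}$ and $z^{+}=e^{i\theta^{+}}$ with $\theta<\theta^{+}<\theta+2\pi$ are consecutive distinct zeros of $\mathcal{L}$ if they are distinct zeros of $\mathcal{L}$ and $\mathcal{L}$ has no zero on the open arc $\{e^{it}:\theta<t<\theta^{+}\}$ (the order is counterclockwise and cyclic). Each $\mathcal{L}(u)/(u-z_j)$ is a monic polynomial of degree $N-1$, so $\mathcal{L}_\lambda$ is a monic polynomial of degree $N-1$. *)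

(* Defs.v *)
From HB Require Import structures.
From mathcomp Require Import all_boot all_order all_algebra.
From mathcomp Require Import complex.
From mathcomp Require Import reals trigo.

Set Implicit Arguments.
Unset Strict Implicit.
Unset Printing Implicit Defensive.

Import Order.TTheory GRing.Theory Num.Theory.
Local Open Scope ring_scope.
Local Open Scope complex_scope.

(* e^{it} *)
Definition expi (R : realType) (t : R) : R[i] := cos t +i* sin t.

(* The unoriented angle in [0, pi] at the vertex a between the vectors ab and
   ac; Re (u * v^* ) is the Euclidean inner product of u and v in R^2 = C.
   Meaningful only when a is distinct from b and c. *)
Definition angle (R : realType) (a b c : R[i]) : R :=
  acos (complex.Re ((b - a) * (c - a)^*)
        / (Normc.normc (b - a) * Normc.normc (c - a))).

(* The angle subtended at a by e^{i t1} and e^{i t2}, with the value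
   (t2 - t1) / 2 by convention when a is one of these two points. *)
Definition Theta (R : realType) (t1 t2 : R) (a : R[i]) : R :=
  if a \in [:: expi t1; expi t2] then (t2 - t1) / 2
  else angle a (expi t1) (expi t2).

Definition Lpoly (R : realType) (N : nat) (z : 'I_N -> R[i]) : {poly R[i]} :=
  \prod_(j < N) ('X - (z j)%:P).

Definition Llambda (R : realType) (N : nat) (z : 'I_N -> R[i])
    (lam : 'I_N -> R) : {poly R[i]} :=
  \sum_(j < N) (lam j)%:C *: (Lpoly z %/ ('X - (z j)%:P)).

(* t1 < t2 < t1 + 2 pi makes the two zeros distinct, and the open
   counterclockwise arc between them is parametrized by ]t1, t2[. *)
Definition consecutive_zeros (R : realType) (p : {poly R[i]}) (t1 t2 : R) :
    Prop :=
  [/\ t1 < t2 < t1 + 2 * pi, root p (expi t1), root p (expi t2)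
    & forall t : R, t1 < t < t2 -> ~~ root p (expi t)].

(* s lists the zeros of p, each repeated according to its multiplicity;
   meaningful for p != 0. *)
Definition zeros_with_multiplicity (R : realType) (p : {poly R[i]})
    (s : seq R[i]) : Prop :=
  forall x : R[i], count_mem x s = mup x p.

(* Main.v *)
Require Import Defs.
From mathcomp Require Import all_boot all_order all_algebra.
From mathcomp Require Import complex.
From mathcomp Require Import reals trigo.
From mathcomp Require Import boolp classical_sets topology normedtype realfun.
From mathcomp Require Import ring lra.

Import Order.TTheory GRing.Theory Num.Theory.
Import numFieldNormedType.Exports.
Local Open Scope ring_scope.

(** Write [e t] for [expi t], [a] and [b] for the arguments of the two given
    zeros, and let [u = e t] run through the arc from [e a] to [e b].  The sum
    of angles is the total variation of the argument of [Llambda] along this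
    arc, and that variation can be computed a second time on the circle.

    On the one hand, [Llambda = c * prod_k (X - w_k)].  For each zero [w] of
    [Llambda] the function [u - w] has a continuous argument along the arc whose
    variation from [a] to [b] is exactly the angle subtended at [w]
    ([Theta_lift]).  Two facts on the position of [w] make this true for the
    unoriented angle ([Llambda_root_location], an argument of Gauss-Lucas type):
    [w] is either a zero of [L], where the inscribed angle is [(b - a) / 2] in
    agreement with the endpoint convention, or it lies in the open disk and not
    strictly between the chord and the arc, so that the oriented angle does not
    exceed [pi].

    On the other hand, [u * Llambda u = L u * sum_j lam_j * u / (u - z_j)].  Each
    of the [N] factors [u - z_j] of [L u] turns by [(b - a) / 2]
    ([polar_expi_sub]).  On the unit circle [u / (u - z_j)] has real part
    [1 / 2], so that the weighted sum moves along the vertical line of abscissa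
    [1 / 2]; it comes from below at [e a] and leaves upwards at [e b], both
    being poles, and its argument increases by [pi].  Multiplication by a
    positive function of [t] turns this sum into a continuous curve on the
    closed arc, which starts on the negative and ends on the positive imaginary
    axis ([Llambda_on_arc], [weighted_cot_left], [weighted_cot_right]).

    Hence the angles add up to [N * (b - a) / 2 + pi - (b - a)], where the last
    term is the variation of the argument of [u].  The two computations are
    compared through [polar_lift_const]: a continuous choice of arguments of the
    constant [c] on the open arc takes the same value at both ends. *)

Section Argument_variation.
Local Set Implicit Arguments.
Local Unset Strict Implicit.
Local Open Scope complex_scope.
Local Open Scope classical_set_scope.
Variable R : realType.
Implicit Types (x y u w d : R[i]) (a b t s : R).

(** * Arguments of complex numbers *)

Lemma complex_eq x y : complex.Re x = complex.Re y ->
  complex.Im x = complex.Im y -> x = y.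
Proof. by case: x => ? ?; case: y => ? ? /= -> ->. Qed.

Lemma expiD a b : expi (a + b) = expi a * expi b.
Proof. by apply: complex_eq; rewrite /= ?cosD ?sinD; ring. Qed.

Lemma expi0 : expi (0 : R) = 1.
Proof. by rewrite /expi cos0 sin0. Qed.

Lemma expiNK a : expi (- a) * expi a = 1.
Proof. by rewrite -expiD addNr expi0. Qed.

Lemma expi_neq0 a : expi a != 0.
Proof.
by apply/eqP => h; have := oner_neq0 R[i]; rewrite -(expiNK a) h mulr0 eqxx.
Qed.

Lemma normc_expi a : Normc.normc (expi a) = 1.
Proof. by rewrite /= cos2Dsin2 sqrtr1. Qed.

Lemma realC_neq0 a : 0 < a -> a%:C != 0.
Proof. by move=> a0; rewrite eq_complex /= negb_and gt_eqF. Qed.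

(** [polar x a]: the real number [a] is an argument of [x], and [x] is
    nonzero.  Arguments are not normalized to a fundamental interval. *)
Definition polar (x : R[i]) (a : R) : Prop :=
  exists2 r : R, 0 < r & x = r%:C * expi a.

Lemma polarM x y a b : polar x a -> polar y b -> polar (x * y) (a + b).
Proof.
move=> [r r0 ->] [s s0 ->]; exists (r * s); first exact: mulr_gt0.
by rewrite expiD rmorphM /=; ring.
Qed.

Lemma polar_expi a : polar (expi a) a.
Proof. by exists 1; rewrite // mul1r. Qed.

Lemma polar_pos a : 0 < a -> polar a%:C 0.
Proof. by move=> a0; exists a; rewrite // expi0 mulr1. Qed.

Lemma polar_prod (I : finType) (F : I -> R[i]) (A : I -> R) :
  (forall i, polar (F i) (A i)) -> polar (\prod_i F i) (\sum_i A i).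
Proof.
move=> h; apply: (big_ind2 (fun x a => polar x a)) => //.
- by exists 1; rewrite // expi0 mulr1.
- by move=> *; exact: polarM.
Qed.

Lemma polar_neq0 x a : polar x a -> x != 0.
Proof.
move=> [r r0 ->]; rewrite mulf_neq0 ?expi_neq0 //.
exact: realC_neq0.
Qed.

Lemma polar_div x y a b : polar (x * y) a -> polar y b -> polar x (a - b).
Proof.
move=> [r r0 xy] [s s0 ys]; exists (r / s); first exact: divr_gt0.
have s1 := realC_neq0 s0.
have yb : y * expi (- b) = s%:C by rewrite ys -mulrA [_ * expi _]mulrC expiNK mulr1.
apply: (mulIf s1); rewrite -{1}yb mulrA xy.
rewrite expiD rmorphM fmorphV /=; field.
exact: s1.
Qed.

Lemma polar_conj x a : polar x a -> polar x^* (- a).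
Proof.
move=> [r r0 ->]; exists r => //.
by apply: complex_eq; rewrite /= cosN sinN; ring.
Qed.

Lemma polar_Im x a : polar x a -> exists2 r, 0 < r & complex.Im x = r * sin a.
Proof. by move=> [r r0 ->]; exists r => //=; ring. Qed.

Lemma polar_sin_eq0 x a b : polar x a -> polar x b -> sin (a - b) = 0.
Proof.
move=> xa xb; have := xa; rewrite -[x]mul1r => /polar_div/(_ xb) [r r0 /eqP].
rewrite eq_complex /= => /andP[_ /eqP]; rewrite mul0r addr0 => h.
by move/esym/eqP: h; rewrite mulf_eq0 gt_eqF //= => /eqP.
Qed.

(** A continuous choice of arguments of a fixed [x] is constant: by the
    intermediate value theorem, otherwise every number strictly between [G a]
    and [G b] would be an argument of [x].  Nothing is assumed of the values of
    [G] at the end points, apart from continuity. *)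
Lemma polar_lift_const x (G : R -> R) a b : a < b ->
  (forall t, a <= t <= b -> {for t, continuous G}) ->
  (forall t, a < t < b -> polar x (G t)) -> G a = G b.
Proof.
move=> ab cG pG; apply/eqP/negPn/negP => neq.
set m := Num.min (G a) (G b); set M := Num.max (G a) (G b).
have mM : m < M by rewrite /m /M; case: (ltgtP (G a) (G b)) neq.
have mid v : m < v < M -> polar x v.
  move=> /andP[mv vM]; have [] := @IVT R G a b v (ltW ab).
  - apply: continuous_in_subspaceT => t; rewrite inE /= in_itv /=; exact: cG.
  - by rewrite -/m -/M !ltW.
  move=> t; rewrite in_itv /= => /andP[at_ tb] Gt; rewrite -Gt; apply: pG.
  rewrite !lt_neqAle at_ tb !andbT; apply/andP; split; apply/eqP => e.
  - by move: mv vM; rewrite /m /M -Gt -e; case: (ltgtP (G a) (G b)); lra.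
  - by move: mv vM; rewrite /m /M -Gt e; case: (ltgtP (G a) (G b)); lra.
(* [m + d] and [m + 2 * d] are two values in ]m, M[ at distance less than [pi] *)
have p0 := pi_gt0 R.
set d := Num.min ((M - m) / 3) (pi / 2).
have d0 : 0 < d by rewrite lt_min; apply/andP; split; lra.
have dM : d <= (M - m) / 3 by rewrite ge_min lexx.
have dp : d <= pi / 2 by rewrite ge_min lexx orbT.
have p1 : polar x (m + d) by apply: mid; lra.
have p2 : polar x (m + d + d) by apply: mid; lra.
have := polar_sin_eq0 p2 p1; rewrite (_ : _ - _ = d); last by ring.
by apply/eqP; rewrite gt_eqF // sin_gt0_pi //; lra.
Qed.

(** The unoriented angle is the difference of two arguments as soon as this
    difference lies between [0] and [pi]. *)
Lemma angle_polar a b x y z : polar (y - x) a -> polar (z - x) b ->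
  0 <= b - a <= pi -> angle x y z = b - a.
Proof.
move=> [r r0 yE] [s s0 zE] ba; rewrite /angle yE zE !Normc.normcM !normc_expi !mulr1.
have nC c : 0 < c -> Normc.normc c%:C = c.
  by move=> c0; rewrite /= expr0n addr0 sqrtr_sqr gtr0_norm.
rewrite !nC //= (_ : _ / _ = cos (b - a)) ?cosK // cosB.
by field; rewrite !gt_eqF.
Qed.

(** The principal argument, by the half-angle formula.  It is an argument of [x]
    off the closed negative real axis, that is, where [Re x + |x|] is
    positive. *)
Definition carg (x : R[i]) : R :=
  2 * atan (complex.Im x / (complex.Re x + Normc.normc x)).

Lemma sqr_normcE x :
  Normc.normc x ^+ 2 = complex.Re x ^+ 2 + complex.Im x ^+ 2.
Proof. by case: x => u v /=; rewrite sqr_sqrtr // addr_ge0 ?sqr_ge0. Qed.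

Lemma normc_nonneg x : 0 <= Normc.normc x.
Proof. by case: x => u v; apply: sqrtr_ge0. Qed.

Lemma polar_carg x : 0 < complex.Re x + Normc.normc x -> polar x (carg x).
Proof.
have := sqr_normcE x; have := normc_nonneg x; rewrite /carg.
move: (Normc.normc x) (complex.Re x) (complex.Im x) (@complex_eq x) => r u v xE r0 rE s0.
have r1 : 0 < r.
  rewrite lt0r r0 andbT; apply/eqP => e; rewrite e in rE s0; nra.
exists r => //.
set q := v / (u + r); set a := atan q.
have q2 : 1 + q ^+ 2 = 2 * r / (u + r).
  rewrite /q; apply: (mulIf (x := (u + r) ^+ 2)); first by rewrite expf_neq0 // gt_eqF.
  transitivity ((u + r) ^+ 2 + v ^+ 2); first by field; rewrite gt_eqF.
  rewrite (_ : v ^+ 2 = r ^+ 2 - u ^+ 2); last by rewrite rE; ring.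
  by field; rewrite gt_eqF.
have c2 : cos a ^+ 2 = (u + r) / (2 * r).
  rewrite /a cos_atan exprVn sqr_sqrtr; last by rewrite addr_ge0 ?sqr_ge0.
  by rewrite q2; field; rewrite !gt_eqF.
have c0 : cos a != 0.
  apply/eqP => e; move: c2; rewrite e expr0n /= => /esym/eqP.
  by rewrite mulf_eq0 invr_eq0 !gt_eqF // mulr_gt0.
have sE : sin a = q * cos a.
  by rewrite -[q]atanK -/a /tan mulfVK.
apply: xE; rewrite /= mulr_natl.
- rewrite cos_mulr2n c2 mul0r subr0; field; rewrite gt_eqF //.
- rewrite sin_mulr2n sE mul0r addr0 (_ : cos a * _ = q * cos a ^+ 2); last by ring.
  by rewrite c2 /q; field; rewrite !gt_eqF.
Qed.

Lemma carg_bounds x : 0 < complex.Re x -> - (pi / 2) < carg x < pi / 2.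
Proof.
have := sqr_normcE x; have := normc_nonneg x; rewrite /carg.
move: (Normc.normc x) (complex.Re x) (complex.Im x) => r u v r0 rE u0.
have : atan (v / (u + r)) < atan 1.
  by apply: lt_atan; rewrite ltr_pdivrMr; nra.
have : atan (- 1) < atan (v / (u + r)).
  by apply: lt_atan; rewrite ltr_pdivlMr; nra.
rewrite atanN atan1; lra.
Qed.

Lemma carg_pi x : - pi < carg x < pi.
Proof. by rewrite /carg; set q := _ / _; have := atan_gtNpi2 q; have := atan_ltpi2 q; lra. Qed.

Lemma carg_imag_pos t : 0 < t -> carg (0 +i* t) = pi / 2.
Proof.
move=> t0; rewrite /carg /= expr0n !add0r sqrtr_sqr gtr0_norm // divff ?gt_eqF //.
by rewrite atan1; field.
Qed.

Lemma carg_imag_neg t : t < 0 -> carg (0 +i* t) = - (pi / 2).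
Proof.
move=> t0; rewrite /carg /= expr0n !add0r sqrtr_sqr ltr0_norm // invrN mulrN.
by rewrite divff ?lt_eqF // atanN atan1; field.
Qed.

Lemma continuous_carg (f g : R -> R) t :
  {for t, continuous f} -> {for t, continuous g} ->
  0 < f t + Normc.normc (f t +i* g t) ->
  {for t, continuous (fun s => carg (f s +i* g s))}.
Proof.
move=> cf cg pos; rewrite /carg /=.
apply: continuousM; first exact: cst_continuous.
apply: (@continuous_comp _ _ _ _ (@atan R)); last exact: continuous_atan.
apply: continuousM => //; apply: continuousV; first by rewrite gt_eqF.
apply: continuousD => //.
apply: (@continuous_comp _ _ _ _ (@Num.sqrt R)); last exact: sqrt_continuous.
by apply: continuousD; apply: continuousM.
Qed.

(** * Chords of the unit circle *)

(** The argument of a chord of the unit circle depends affinely on the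
    arguments of its end points; this is the inscribed angle theorem. *)
Lemma expi_sub t s :
  expi t - expi s = (2 * sin ((s - t) / 2))%:C * expi ((t + s) / 2 - pi / 2).
Proof.
set m := (t + s) / 2; set h := (s - t) / 2.
have -> : t = m - h by rewrite /m /h; field.
have -> : s = m + h by rewrite /m /h; field.
apply: complex_eq; rewrite /= sinBpihalf cosBpihalf ?sinB ?sinD ?cosB ?cosD; ring.
Qed.

Lemma sin_half_gt0 a : 0 < a < 2 * pi -> 0 < sin (a / 2).
Proof. by move=> ?; apply: sin_gt0_pi; lra. Qed.

Lemma polar_expi_sub t s : 0 < s - t < 2 * pi ->
  polar (expi t - expi s) ((t + s) / 2 - pi / 2).
Proof.
by move=> h; rewrite expi_sub; eexists; last reflexivity; rewrite mulr_gt0 // sin_half_gt0.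
Qed.

Lemma expi_pi : expi (pi : R) = -1.
Proof. by rewrite /expi cospi sinpi; apply: complex_eq; rewrite //= oppr0. Qed.

Lemma expiD2pi a : expi (a + 2 * pi) = expi a.
Proof. by rewrite mulr_natl mulr2n addrA (expiD (a + pi)) (expiD a) expi_pi; ring. Qed.

Lemma unit_expi a x : Normc.normc x = 1 ->
  exists2 s, a < s <= a + 2 * pi & x = expi s.
Proof.
move=> x1; have p0 := pi_gt0 R.
have [->|xa] := eqVneq x (expi a); first by exists (a + 2 * pi); [lra|rewrite expiD2pi].
(* [y = - x / e a] avoids the closed negative real axis, because [x] is not
   [e a] *)
set y := - x * expi (- a).
have xE : x = - y * expi a by rewrite /y !mulNr opprK -mulrA expiNK mulr1.
have y1 : Normc.normc y = 1 by rewrite /y Normc.normcM normc_expi mulr1 normcN.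
have := sqr_normcE y; rewrite y1 => yE.
have ly : 0 < complex.Re y + Normc.normc y.
  rewrite ltNge; apply/negP => le; case/eqP: xa.
  rewrite xE (_ : y = -1) ?opprK ?mul1r //.
  by apply: complex_eq => /=; nra.
have [r r0 yr] := polar_carg ly.
have r1 : r = 1.
  move: y1; rewrite yr Normc.normcM normc_expi mulr1 /= expr0n addr0 sqrtr_sqr.
  by rewrite gtr0_norm.
exists (a + pi + carg y); first by have := carg_pi y; lra.
by rewrite xE {1}yr r1 (expiD (a + pi)) (expiD a) expi_pi; ring.
Qed.

Lemma sin_gt0_itv a : - pi <= a <= 2 * pi -> 0 < sin a -> 0 < a < pi.
Proof.
move=> ha sa; have p0 := pi_gt0 R; apply/andP; split; rewrite ltNge; apply/negP => le.
- have : 0 <= sin (- a) by apply: sin_ge0_pi; lra.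
  by rewrite sinN; lra.
- have : 0 <= sin (a - pi) by apply: sin_ge0_pi; lra.
  by rewrite sinB cospi sinpi; lra.
Qed.

Lemma sin_ge0_itv a : 0 <= a < 2 * pi -> 0 <= sin a -> a <= pi.
Proof.
move=> ha sa; rewrite leNgt; apply/negP => lt.
have : 0 < sin (a - pi) by apply: sin_gt0_pi; lra.
by rewrite sinB cospi sinpi; lra.
Qed.

Lemma cos_le_itv a b : 0 <= b <= pi -> b <= a <= 2 * pi - b -> cos a <= cos b.
Proof.
move=> hb ha; have h1 : 0 <= sin ((a + b) / 2) by apply: sin_ge0_pi; lra.
have h2 : 0 <= sin ((a - b) / 2) by apply: sin_ge0_pi; lra.
suff : cos b - cos a = 2 * (sin ((a + b) / 2) * sin ((a - b) / 2)).
  by have := mulr_ge0 h1 h2; lra.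
set p := (a + b) / 2; set q := (a - b) / 2.
have -> : b = p - q by rewrite /p /q; field.
have -> : a = p + q by rewrite /p /q; field.
by rewrite cosB cosD; ring.
Qed.

(** For [w] in the open disk, [e t - w] has a continuous argument [A] for all real
    [t].  The hypothesis on the real part says that [w] is not on the same side
    of the line through [e a] and [e b] as the arc from [e a] to [e b]; under it
    the variation of [A] from [a] to [b] is the unoriented angle at [w]. *)
Lemma angle_interior a b w : a < b < a + 2 * pi -> Normc.normc w < 1 ->
  complex.Re (w * expi (- ((a + b) / 2))) <= cos ((b - a) / 2) ->
  exists A : R -> R, [/\ forall t, {for t, continuous A},
    forall t, polar (expi t - w) (A t)
    & A b - A a = angle w (expi a) (expi b)].
Proof.
move=> ab w1; set m := (a + b) / 2; set h := (b - a) / 2; set v := w * _ => vh.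
have p0 := pi_gt0 R; have w0 := normc_nonneg w; have wE := sqr_normcE w.
(* [e t - w = e t * (1 - w * e (- t))], where the second factor has a positive
   real part because [|w| < 1] *)
pose B t := carg ((1 - complex.Re (w * expi (- t))) +i* (- complex.Im (w * expi (- t)))).
have BE t : (1 - complex.Re (w * expi (- t))) +i* (- complex.Im (w * expi (- t))) = 1 - w * expi (- t).
  by case: (w) => p q; apply: complex_eq; rewrite /=; ring.
have nw t : complex.Re (w * expi (- t)) < 1.
  have := sqr_normcE (w * expi (- t)); rewrite Normc.normcM normc_expi mulr1.
  move: (complex.Re _) (complex.Im _) => p q; nra.
have Bb t : - (pi / 2) < B t < pi / 2 by apply: carg_bounds; rewrite /= subr_gt0; exact: nw.
have Bp t : polar (1 - w * expi (- t)) (B t).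
  rewrite /B BE; apply: polar_carg; rewrite -BE /=.
  by apply: ltr_wpDr; [exact: sqrtr_ge0|rewrite subr_gt0; exact: nw].
have Ap t : polar (expi t - w) (t + B t).
  have -> : expi t - w = expi t * (1 - w * expi (- t)).
    by rewrite mulrBr mulr1 mulrCA [expi t * _]mulrC expiNK mulr1.
  by apply: polarM => //; exact: polar_expi.
have cexp s : {for s, continuous (fun t : R => cos (- t))} /\ {for s, continuous (fun t : R => sin (- t))}.
  split.
    by apply: (@continuous_comp _ _ _ (@GRing.opp R) (@cos R)); [exact: opp_continuous|exact: continuous_cos].
  by apply: (@continuous_comp _ _ _ (@GRing.opp R) (@sin R)); [exact: opp_continuous|exact: continuous_sin].
have cw s : {for s, continuous (fun t : R => complex.Re (w * expi (- t)))} /\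
            {for s, continuous (fun t : R => complex.Im (w * expi (- t)))}.
  case: (w) => p q /=; have [? ?] := cexp s; split.
  - by apply: continuousB; apply: continuousM => //; exact: cst_continuous.
  - by apply: continuousD; apply: continuousM => //; exact: cst_continuous.
exists (fun t => t + B t); split=> //.
- move=> t; apply: continuousD => //; apply: continuous_carg.
  + by apply: continuousB; [exact: cst_continuous|exact: (cw t).1].
  + by apply: continuousN; exact: (cw t).2.
  + by apply: ltr_wpDr; [exact: normc_nonneg|rewrite subr_gt0; exact: nw].
(* The crude bounds on [B] only give [- pi < psi - h < 2 * pi].  The sign of
   [sin (psi - h)] narrows this to [h < psi < h + pi], and then the sign of
   [sin psi] gives [psi <= pi].  Both signs are read off an explicit imaginary
   part, after the rotation which makes the arc symmetric about the real
   axis. *)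
set psi := (X in X = _).
have hb : 0 < h < pi by rewrite /h; lra.
have sh : 0 < sin h by exact: sin_gt0_pi.
set x := (expi b - w) * (expi a - w)^*.
have px : polar x psi by rewrite /psi; apply: polarM; [|apply: polar_conj]; exact: Ap.
have xE : x = (expi h - v) * (expi h - v^*).
  have EE : expi m * (expi m)^* = 1.
    by apply: complex_eq; rewrite /= ?mulrN ?opprK -?expr2 ?cos2Dsin2 //; ring.
  have -> : x = (expi m * expi h - v * expi m) * ((expi m)^* * expi h - v^* * (expi m)^*).
    rewrite /x -expiD (_ : m + h = b); last by rewrite /m /h; field.
    rewrite /v -mulrA expiNK mulr1; congr (_ * _).
    rewrite rmorphB; congr (_ - _).
      rewrite (_ : a = m - h); last by rewrite /m /h; field.
      by apply: complex_eq; rewrite /= ?cosB ?sinB; ring.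
    by rewrite -rmorphM /= -mulrA expiNK mulr1.
  transitivity ((expi m * (expi m)^*) * ((expi h - v) * (expi h - v^*))); first by ring.
  by rewrite EE mul1r.
have [r r0 rE] := polar_Im px.
have [r' r'0 r'E] : exists2 r, 0 < r & complex.Im (x * expi (- h)) = r * sin (psi - h).
  by apply: polar_Im; apply: polarM => //; exact: polar_expi.
have v1 : complex.Re v ^+ 2 + complex.Im v ^+ 2 < 1.
  rewrite -sqr_normcE /v Normc.normcM normc_expi mulr1.
  by rewrite expr_lt1.
have hh := cos2Dsin2 h.
have I1 : complex.Im x = 2 * (sin h * (cos h - complex.Re v)).
  by rewrite xE; case: (v) => p q /=; ring.
have I2 : complex.Im (x * expi (- h)) = sin h * (1 - (complex.Re v ^+ 2 + complex.Im v ^+ 2)).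
  by rewrite xE -hh; case: (v) v1 {vh I1} => p q /= _; rewrite cosN sinN; ring: hh.
have s1 : 0 < sin (psi - h).
  by rewrite -(pmulr_rgt0 _ r'0) -r'E I2 mulr_gt0 // subr_gt0.
have s2 : 0 <= sin psi.
  by rewrite -(pmulr_rge0 _ r0) -rE I1 !mulr_ge0 ?(ltW sh) // subr_ge0.
have b1 : 0 < psi - h < pi.
  by apply: sin_gt0_itv => //; have := Bb a; have := Bb b; rewrite /psi /h; lra.
have b2 : psi <= pi by apply: sin_ge0_itv => //; move: b1 hb; lra.
by rewrite (angle_polar (Ap a) (Ap b)) // -/psi; move: b1 b2 hb; lra.
Qed.

(** * The polynomials [L] and [Llambda] *)

Lemma normc_eq1 (x : R[i]) : `|x| = 1 -> Normc.normc x = 1.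
Proof. by rewrite normc_def; case: x => p q [] /=. Qed.

Lemma Re_sum (I : finType) (F : I -> R[i]) :
  complex.Re (\sum_i F i) = \sum_i complex.Re (F i).
Proof. by apply: (big_morph (@complex.Re R)) => // -[? ?] [? ?]. Qed.

Lemma Im_sum (I : finType) (F : I -> R[i]) :
  complex.Im (\sum_i F i) = \sum_i complex.Im (F i).
Proof. by apply: (big_morph (@complex.Im R)) => // -[? ?] [? ?]. Qed.

Lemma factor_zeros (p : {poly R[i]}) (n : nat) (w : n.-tuple R[i]) :
  p != 0 -> zeros_with_multiplicity p w -> p = lead_coef p *: Lpoly (tnth w).
Proof.
move=> p0 hw; have [r rE] := closed_field_poly_normal p.
rewrite {1}rE; congr (_ *: _).
have -> : Lpoly (tnth w) = \prod_(x <- w) ('X - x%:P) by rewrite big_tuple.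
apply: perm_big; apply/allP => x _ /=; apply/eqP; rewrite hw rE.
by rewrite -mul_polyC mupMr ?mu_prod_XsubC // rootC lead_coef_eq0.
Qed.

Section Weighted.
Variables (N : nat) (z : 'I_N -> R[i]) (lam : 'I_N -> R).

Lemma root_Lpoly u : root (Lpoly z) u -> exists j, u = z j.
Proof.
rewrite /root horner_prod => /prodf_eq0 [j _].
by rewrite hornerXsubC subr_eq0 => /eqP; exists j.
Qed.

Lemma horner_Lpoly u : (Lpoly z).[u] = \prod_j (u - z j).
Proof. by rewrite horner_prod; apply: eq_bigr => j _; rewrite hornerXsubC. Qed.

Lemma horner_Llambda u : (forall j, u != z j) ->
  (Llambda z lam).[u] = (Lpoly z).[u] * \sum_j (lam j)%:C / (u - z j).
Proof.
move=> uz; rewrite horner_sum mulr_sumr; apply: eq_bigr => j _.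
rewrite hornerZ; have uj : u - z j != 0 by rewrite subr_eq0.
have -> : Lpoly z = (Lpoly z %/ ('X - (z j)%:P)) * ('X - (z j)%:P).
  by rewrite divpK // dvdp_XsubCl /root horner_Lpoly (bigD1 j) //= subrr mul0r.
rewrite mulpK ?polyXsubC_eq0 // hornerM hornerXsubC; field.
exact: uj.
Qed.

(** The mechanism of the Gauss-Lucas theorem: all the [z j] lie in an open half
    plane of which [u] is a boundary point, [d] being its outer normal, so that
    the terms [lam j / (u - z j)] all have a positive component along the
    conjugate of [d] and cannot add up to zero. *)
Lemma Llambda_neq0 d u : (0 < N)%N -> (forall j, 0 < lam j) ->
  (forall j, 0 < complex.Re (d * (u - z j)^*)) -> (Llambda z lam).[u] != 0.
Proof.
move=> N0 lam0 hd.
have uz j : u != z j.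
  by apply/eqP => e; have := hd j; rewrite e subrr rmorph0 mulr0 ltxx.
rewrite horner_Llambda // mulf_neq0 //.
  by rewrite horner_Lpoly; apply/prodf_neq0 => j _; rewrite subr_eq0.
apply/eqP => e; have : complex.Re (d * \sum_j (lam j)%:C / (u - z j)) = 0.
  by rewrite e mulr0.
rewrite mulr_sumr Re_sum => /eqP.
have pos j : 0 < complex.Re (d * ((lam j)%:C / (u - z j))).
  have := hd j; have := uz j; rewrite -subr_eq0; case: (u - z j) => p q nz.
  have n0 : 0 < p ^+ 2 + q ^+ 2.
    rewrite lt0r addr_ge0 ?sqr_ge0 // andbT paddr_eq0 ?sqr_ge0 // !sqrf_eq0.
    by move: nz; rewrite eq_complex.
  set n := p ^+ 2 + q ^+ 2 in n0 *; set v := p +i* q in nz *.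
  have vv : v^* * v = n%:C by apply: complex_eq; rewrite /= /n; ring.
  have -> : (lam j)%:C / v = (lam j / n)%:C * v^*.
    apply: (mulIf nz); rewrite divfK // -mulrA vv -rmorphM /= divfK // gt_eqF //.
  rewrite mulrCA; move: (d * v^*) => [c c'] /= c0.
  by rewrite mul0r subr0 mulr_gt0 // divr_gt0.
by rewrite psumr_eq0 => [/allP/(_ (Ordinal N0))|j _]; rewrite ?mem_index_enum ?gt_eqF //= ?ltW // => /(_ isT).
Qed.

End Weighted.

(** * The weighted sum of the [u / (u - z_j)] on the arc *)

Lemma continuous_half_sub s :
  (forall t, {for t, continuous (fun t => sin ((s - t) / 2))}) /\
  (forall t, {for t, continuous (fun t => cos ((s - t) / 2))}).
Proof.
have c t : {for t, continuous (fun t : R => (s - t) / 2)}.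
  by apply: continuousM; [apply: continuousB; [exact: cst_continuous|by []]|exact: cst_continuous].
split=> t.
- by apply: (@continuous_comp _ _ _ (fun t => (s - t) / 2) (@sin R));
  [exact: c|exact: continuous_sin].
- by apply: (@continuous_comp _ _ _ (fun t => (s - t) / 2) (@cos R));
  [exact: c|exact: continuous_cos].
Qed.

Lemma continuous_sub_half s :
  (forall t, {for t, continuous (fun t => sin ((t - s) / 2))}) /\
  (forall t, {for t, continuous (fun t => cos ((t - s) / 2))}).
Proof.
have c t : {for t, continuous (fun t : R => (t - s) / 2)}.
  by apply: continuousM; [apply: continuousB; [by []|exact: cst_continuous]|exact: cst_continuous].
split=> t.
- by apply: (@continuous_comp _ _ _ (fun t => (t - s) / 2) (@sin R));
  [exact: c|exact: continuous_sin].
- by apply: (@continuous_comp _ _ _ (fun t => (t - s) / 2) (@cos R));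
  [exact: c|exact: continuous_cos].
Qed.

Lemma continuous_sum (I : finType) (F : I -> R -> R) (t : R) :
  (forall i, {for t, continuous (F i)}) ->
  {for t, continuous (fun s => \sum_i F i s)}.
Proof.
move=> cF; elim: (index_enum I) => [|i r IH].
  under [X in {for t, continuous X}]eq_fun do rewrite big_nil.
  exact: cst_continuous.
under [X in {for t, continuous X}]eq_fun do rewrite big_cons.
exact: continuousD.
Qed.

Section Arc.
Variables a b : R.
Hypothesis ab : a < b < a + 2 * pi.

(** A function of [t] which is positive on ]a, b[ when [a < b < a + 2 * pi], and
    vanishes at [a] and [b]; it clears the poles of [u / (u - z_j)] at the ends
    of the arc. *)
Definition arc_bump t : R := sin ((t - a) / 2) * sin ((b - t) / 2).

(** [arc_bump t * cot ((s - t) / 2)], extended by continuity to [t = a] and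
    [t = b] when the cotangent has a pole there, that is when [s = a + 2 * pi]
    or [s = b]. *)
Definition arc_cot s t : R :=
  if s == b then sin ((t - a) / 2) * cos ((b - t) / 2)
  else if s == a + 2 * pi then - (sin ((b - t) / 2) * cos ((t - a) / 2))
  else arc_bump t * cos ((s - t) / 2) / sin ((s - t) / 2).

Lemma arc_bump_gt0 t : a < t < b -> b < a + 2 * pi -> 0 < arc_bump t.
Proof. by move=> ht hb; rewrite mulr_gt0 // sin_half_gt0 //; lra. Qed.

Lemma arc_bump_left : arc_bump a = 0.
Proof. by rewrite /arc_bump subrr mul0r sin0 mul0r. Qed.

Lemma arc_bump_right : arc_bump b = 0.
Proof. by rewrite /arc_bump subrr mul0r sin0 mulr0. Qed.

Lemma arc_cotE s t : a < t < b -> b <= s <= a + 2 * pi ->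
  sin ((s - t) / 2) * arc_cot s t
  = arc_bump t * cos ((s - t) / 2).
Proof.
move=> ht hs; rewrite /arc_cot /arc_bump; case: eqP => [->|_]; first by ring.
case: eqP => [->|_].
  have -> : (a + 2 * pi - t) / 2 = pi - (t - a) / 2 by field.
  by rewrite sinB cosB sinpi cospi; ring.
by field; rewrite gt_eqF // sin_half_gt0 //; lra.
Qed.

Lemma arc_cot_left s : b <= s <= a + 2 * pi ->
  arc_cot s a <= 0 /\ (s = a + 2 * pi -> arc_cot s a < 0).
Proof.
move=> hs; have sh : 0 < sin ((b - a) / 2) by apply: sin_half_gt0; move: (ab); lra.
rewrite /arc_cot /arc_bump subrr mul0r sin0 cos0 !mul0r mulr1.
case: eqP => [->|_]; first by split=> // e; move: ab; rewrite e ltxx andbF.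
by case: eqP => // _; split=> // *; rewrite ?oppr_le0 ?oppr_lt0 // ltW.
Qed.

Lemma arc_cot_right s : b <= s <= a + 2 * pi ->
  0 <= arc_cot s b /\ (s = b -> 0 < arc_cot s b).
Proof.
move=> hs; have sh : 0 < sin ((b - a) / 2) by apply: sin_half_gt0; move: (ab); lra.
rewrite /arc_cot /arc_bump subrr mul0r sin0 cos0 mulr0 !mul0r mulr1 oppr0.
case: eqP => [_|ne]; first by split=> [|_]; [exact: (ltW sh)|exact: sh].
by split=> [|e]; [case: ifP|case: (ne e)].
Qed.

Lemma continuous_arc_cot s t : b <= s <= a + 2 * pi -> a <= t <= b ->
  {for t, continuous (arc_cot s)}.
Proof.
move=> hs ht; have [s1 c1] := continuous_sub_half a.
have [s2 c2] := continuous_half_sub b; have [s3 c3] := continuous_half_sub s.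
rewrite /arc_cot /arc_bump; case: eqP => [sb|/eqP sb]; first exact: continuousM.
case: eqP => [sa|/eqP sa]; first by apply: continuousN; apply: continuousM.
apply: continuousM; first by apply: continuousM => //; apply: continuousM.
apply: continuousV => //; rewrite gt_eqF // sin_half_gt0 //.
by move: hs; rewrite le_eqVlt [b == s]eq_sym (negbTE sb) /= le_eqVlt (negbTE sa) /=; lra.
Qed.

(** [u / (u - e s)] has real part [1 / 2] and imaginary part
    [cot ((s - t) / 2) / 2] at [u = e t]. *)
Lemma arc_ratio s t : a < t < b -> b <= s <= a + 2 * pi ->
  (2 * arc_bump t)%:C * expi t / (expi t - expi s)
  = arc_bump t +i* arc_cot s t.
Proof.
move=> ht hs; set K := arc_bump t; have st : 0 < s - t < 2 * pi by lra.
apply: (mulIf (polar_neq0 (polar_expi_sub st))).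
rewrite divfK ?(polar_neq0 (polar_expi_sub st)) //.
have h := arc_cotE ht hs; rewrite -/K in h.
rewrite expi_sub rmorphM /=.
transitivity (2 * ((sin ((s - t) / 2))%:C * (K +i* arc_cot s t)) * expi ((t + s) / 2 - pi / 2)); last first.
  by rewrite rmorphM /= [2%:C](_ : _ = 2) //; [ring|apply: complex_eq; rewrite //=; ring].
have -> : (sin ((s - t) / 2))%:C * (K +i* arc_cot s t) = K%:C * expi (t + (pi / 2 - (t + s) / 2)).
  rewrite (_ : t + _ = pi / 2 - (s - t) / 2); last by field.
  apply: complex_eq; rewrite /= ?cosB ?sinB cos_pihalf sin_pihalf; last by rewrite mul0r addr0 h; ring.
  by ring.
rewrite expiD -!mulrA -expiD (_ : pi / 2 - _ + _ = 0); last by ring.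
rewrite expi0 mulr1 [2%:C](_ : _ = 2) //; apply: complex_eq; rewrite //=; ring.
Qed.

Section Circle_zeros.
Variables (N : nat) (z : 'I_N -> R[i]) (lam s : 'I_N -> R).
Hypothesis lam_gt0 : forall j, 0 < lam j.
Hypothesis zE : forall j, b <= s j <= a + 2 * pi /\ z j = expi (s j).

(** Up to the factor [arc_bump t], twice the imaginary part of the weighted sum
    of the [u / (u - z_j)] at [u = e t], extended by continuity to the ends of
    the arc. *)
Definition weighted_cot t : R := \sum_j lam j * arc_cot (s j) t.

Lemma Lpoly_arc_neq0 t j : a < t < b -> expi t != z j.
Proof.
move=> ht; have [hj ->] := zE j; rewrite -subr_eq0.
have d : 0 < s j - t < 2 * pi by lra.
exact: polar_neq0 (polar_expi_sub d).
Qed.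

Lemma Llambda_on_arc t : \sum_j lam j = 1 -> a < t < b ->
  (2 * arc_bump t)%:C * expi t * (Llambda z lam).[expi t]
  = (Lpoly z).[expi t] * (arc_bump t +i* weighted_cot t).
Proof.
move=> hsum ht; rewrite horner_Llambda => [|j]; last exact: Lpoly_arc_neq0.
rewrite mulrCA; congr (_ * _).
transitivity (\sum_j (lam j)%:C * (arc_bump t +i* arc_cot (s j) t)).
  rewrite mulr_sumr; apply: eq_bigr => j _; have [hj ->] := zE j.
  by rewrite -(arc_ratio ht hj); ring.
apply: complex_eq; rewrite ?Re_sum ?Im_sum /=.
  by rewrite -[RHS]mul1r -hsum mulr_suml; apply: eq_bigr => j _; ring.
by apply: eq_bigr => j _; ring.
Qed.

Lemma weighted_cot_left : root (Lpoly z) (expi a) -> weighted_cot a < 0.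
Proof.
have hab := ab; move=> ra.
have [j ja] := root_Lpoly ra; have [hj zj] := zE j.
have sj : s j = a + 2 * pi.
  apply/eqP/negPn/negP => ne; have lt : s j < a + 2 * pi.
    by rewrite lt_neqAle ne; case/andP: hj.
  have d : 0 < s j - a < 2 * pi by lra.
  by have := polar_neq0 (polar_expi_sub d); rewrite -zj -ja subrr eqxx.
rewrite -oppr_gt0 /weighted_cot -sumrN (bigD1 j) //= ltr_wpDr //.
  apply: sumr_ge0 => i _; have [hi _] := zE i.
  by rewrite oppr_ge0 mulr_ge0_le0 ?(ltW (lam_gt0 i)) //; case: (arc_cot_left hi).
by rewrite oppr_gt0 pmulr_rlt0 //; case: (arc_cot_left hj) => _; exact.
Qed.

Lemma weighted_cot_right : root (Lpoly z) (expi b) -> 0 < weighted_cot b.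
Proof.
have hab := ab; move=> rb.
have [j jb] := root_Lpoly rb; have [hj zj] := zE j.
have sj : s j = b.
  apply/eqP/negPn/negP => ne; have lt : b < s j.
    by rewrite lt_neqAle eq_sym ne; case/andP: hj.
  have d : 0 < s j - b < 2 * pi by lra.
  by have := polar_neq0 (polar_expi_sub d); rewrite -zj -jb subrr eqxx.
rewrite /weighted_cot (bigD1 j) //= ltr_wpDr //.
  apply: sumr_ge0 => i _; have [hi _] := zE i.
  by rewrite mulr_ge0 ?(ltW (lam_gt0 i)) //; case: (arc_cot_right hi).
by rewrite pmulr_rgt0 //; case: (arc_cot_right hj) => _; exact.
Qed.

Lemma continuous_weighted_cot t : a <= t <= b ->
  {for t, continuous weighted_cot}.
Proof.
move=> ht; apply: continuous_sum => j; apply: continuousM.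
  exact: cst_continuous.
by have [hj _] := zE j; exact: continuous_arc_cot.
Qed.

(** The curve [arc_bump +i* weighted_cot] avoids the closed negative real axis,
    so that [carg] is continuous along it, end points included. *)
Lemma weighted_cot_slit t :
  root (Lpoly z) (expi a) -> root (Lpoly z) (expi b) -> a <= t <= b ->
  0 < arc_bump t + Normc.normc (arc_bump t +i* weighted_cot t).
Proof.
move=> ra rb; rewrite le_eqVlt => /andP[]; case: eqP => [<- _ _|_ /= ta].
  rewrite arc_bump_left add0r /= expr0n add0r sqrtr_sqr normr_gt0 lt_eqF //.
  exact: weighted_cot_left.
rewrite le_eqVlt; case: eqP => [-> _|_ /= tb].
  rewrite arc_bump_right add0r /= expr0n add0r sqrtr_sqr normr_gt0 gt_eqF //.
  exact: weighted_cot_right.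
apply: ltr_wpDr; first exact: sqrtr_ge0.
by apply: arc_bump_gt0; [rewrite ta tb|case/andP: ab].
Qed.

End Circle_zeros.

(** * Zeros of [Llambda] and the angles they subtend *)

(** The two alternatives are those of [Llambda_root_location] below.  In the first
    one [w] is on the circle and off the open arc, and the argument of a chord
    from [w] varies by [(b - a) / 2], which is also the value of [Theta] by
    convention at the end points. *)
Lemma Theta_lift w :
  (exists2 s, b <= s <= a + 2 * pi & w = expi s) \/
  (Normc.normc w < 1 /\
    complex.Re (w * expi (- ((a + b) / 2))) <= cos ((b - a) / 2)) ->
  exists A : R -> R, [/\ forall t, {for t, continuous A},
    forall t, a < t < b -> polar (expi t - w) (A t)
    & A b - A a = Theta a b w].
Proof.
have hab := ab; rewrite /Theta => -[[s hs ->]|[w1 wh]].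
- exists (fun t => (t + s) / 2 - pi / 2); split.
  + move=> t; apply: continuousB; last exact: cst_continuous.
    apply: continuousM; last exact: cst_continuous.
    by apply: continuousD; [by []|exact: cst_continuous].
  + by move=> t ht; apply: polar_expi_sub; lra.
  rewrite !inE; case: ifP => [_|/negbT]; first by field.
  rewrite negb_or => /andP[sa sb].
  have {sa} sa : s != a + 2 * pi by apply: contraNneq sa => ->; rewrite expiD2pi.
  have {sb} sb : s != b by apply: contraNneq sb => ->.
  have hs' : b < s < a + 2 * pi.
    by rewrite !lt_neqAle sa [b == s]eq_sym sb.
  rewrite (@angle_polar ((a + s) / 2 - pi / 2) ((b + s) / 2 - pi / 2)) //.
  + by apply: polar_expi_sub; lra.
  + by apply: polar_expi_sub; lra.
  + by lra.
- have [A [cA pA dA]] := angle_interior ab w1 wh; exists A; split=> //.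
  have ne t : (w == expi t) = false.
    by apply/eqP => e; move: w1; rewrite e normc_expi ltxx.
  by rewrite !inE !ne.
Qed.

(** A zero [w] of [Llambda] is a zero of [L], hence on the circle and off the open
    arc, or else it is in the open disk and not strictly between the chord from
    [e a] to [e b] and the arc: otherwise the half plane condition of
    [Llambda_neq0] holds, with [d = w] if [|w| >= 1], and with [d] the midpoint
    of the arc if [w] is beyond the chord. *)
Lemma Llambda_root_location (N : nat) (z : 'I_N -> R[i]) (lam : 'I_N -> R) w :
  (0 < N)%N -> (forall j, 0 < lam j) ->
  (forall j, exists2 s, b <= s <= a + 2 * pi & z j = expi s) ->
  root (Llambda z lam) w ->
  (exists2 s, b <= s <= a + 2 * pi & w = expi s) \/
  (Normc.normc w < 1 /\
    complex.Re (w * expi (- ((a + b) / 2))) <= cos ((b - a) / 2)).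
Proof.
have hab := ab; move=> N0 lam0 hz rw.
have [/existsP[j /eqP ->]|/existsPn nz] := boolP [exists j, w == z j].
  by left; exact: hz.
right; have hd d : ~ forall j, 0 < complex.Re (d * (w - z j)^*).
  by move=> /(Llambda_neq0 N0 lam0); rewrite -/(root _ w) rw.
have wE := sqr_normcE w; split; rewrite ltNge || rewrite leNgt; apply/negP => lt.
- apply: (hd w) => j; have [s _ zE] := hz j; move: (nz j); rewrite zE.
  have := cos2Dsin2 s; have : 1 <= Normc.normc w ^+ 2 by exact: exprn_ege1.
  rewrite wE; case: (w) => p q /=; rewrite eq_complex /= negb_and.
  move: (cos s) (sin s) => c d h1 h2 h3.
  have h4 : 0 < (p - c) ^+ 2 + (q - d) ^+ 2.
    rewrite lt0r addr_ge0 ?sqr_ge0 // andbT paddr_eq0 ?sqr_ge0 // !sqrf_eq0.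
    by rewrite !subr_eq0 negb_and.
  by nra.
- set m := (a + b) / 2 in lt; apply: (hd (expi m)) => j; have [s hs zE] := hz j.
  have h : cos (m - s) <= cos ((b - a) / 2).
    by rewrite -cosN; apply: cos_le_itv; rewrite /m; lra.
  rewrite rmorphB mulrBr zE.
  move: h lt; rewrite cosB; case: (w) => p q /=; rewrite cosN sinN; lra.
Qed.

End Arc.

End Argument_variation.

Theorem theorem1p4 (R : realType) (N : nat) (hN : (2 <= N)%N)
    (z : 'I_N -> R[i]) (hz : forall j : 'I_N, `|z j| = 1)
    (lam : 'I_N -> R) (hlam : forall j : 'I_N, 0 < lam j)
    (hsum : \sum_(j < N) lam j = 1)
    (theta theta' : R) (hcons : consecutive_zeros (Lpoly z) theta theta')
    (w : (N.-1).-tuple R[i])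
    (hw : zeros_with_multiplicity (Llambda z lam) w) :
  \sum_(k < N.-1) Theta theta theta' (tnth w k)
    = pi + (N - 2)%:R * ((theta' - theta) / 2).
Proof.
have [hab ra rb arc0] := hcons.
set a := theta in hab ra arc0 *; set b := theta' in hab rb arc0 *.
have N0 : (0 < N)%N by apply: leq_trans hN.
(* every [z j] has an argument in ]a, a + 2 * pi], and none in ]a, b[ *)
have zs j : exists2 s, b <= s <= a + 2 * pi & z j = expi s.
  have [s /andP[sa sb] zE] := unit_expi a (normc_eq1 (hz j)).
  exists s => //; rewrite sb andbT leNgt; apply/negP => sltb.
  have := arc0 s; rewrite sa sltb => /(_ isT).
  by rewrite /root horner_Lpoly (bigD1 j) //= zE subrr mul0r eqxx.
have /choice[s sP] j : exists s, b <= s <= a + 2 * pi /\ z j = expi s.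
  by have [s] := zs j; exists s.
(* [2] is outside the closed disk *)
have L0 : Llambda z lam != 0.
  apply/eqP => e; have : (Llambda z lam).[2] != 0.
    apply: (@Llambda_neq0 _ _ _ _ 1) => // j; have [_ ->] := sP j.
    by rewrite mul1r /=; have := cos_le1 (s j); lra.
  by rewrite e horner0 eqxx.
have LE := factor_zeros L0 hw; set c := lead_coef _ in LE.
have wroot k : root (Llambda z lam) (tnth w k).
  by rewrite LE rootZ ?lead_coef_eq0 // /root horner_Lpoly (bigD1 k) //= subrr mul0r.
have /choice[A AP] k : exists A : R -> R,
    [/\ forall t, {for t, continuous A}%classic,
    forall t, a < t < b -> polar (expi t - tnth w k) (A t)
    & A b - A a = Theta a b (tnth w k)].
  by apply: Theta_lift => //; exact: (Llambda_root_location _ N0 hlam zs).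
pose K := arc_bump a b; pose Y := weighted_cot a b lam s.
(* an argument of [L (e t)] *)
pose M t := \sum_(j < N) ((t + s j) / 2 - pi / 2).
(* an argument of [c], as the quotient of [L u] times the curve by
   [u * prod_k (u - w_k)] at [u = e t] *)
pose G t := M t + carg (complex.Complex (K t) (Y t)) - (\sum_k A k t + t).
have Gc t : a < t < b -> polar c (G t).
  move=> ht; have [_ hb] := andP hab; have Kt := arc_bump_gt0 ht hb.
  have E : c * (\prod_k (expi t - tnth w k) * expi t) * (2 * K t)%:C%C
      = \prod_j (expi t - z j) * complex.Complex (K t) (Y t).
    rewrite -(horner_Lpoly z) -(Llambda_on_arc sP hsum ht) LE hornerZ.
    by rewrite horner_Lpoly; ring.
  apply: (@polar_div _ _ (\prod_k (expi t - tnth w k) * expi t)).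
    rewrite -[X in polar _ X]subr0; apply: (@polar_div _ _ (2 * K t)%:C%C).
      rewrite E; apply: polarM.
        by apply: polar_prod => j; have [hj ->] := sP j; apply: polar_expi_sub; lra.
      by apply: polar_carg; apply: weighted_cot_slit => //; lra.
    by apply: polar_pos; rewrite mulr_gt0.
  apply: polarM; last exact: polar_expi.
  by apply: polar_prod => k; have [_ + _] := AP k; exact.
have cG t : a <= t <= b -> {for t, continuous G}%classic.
  move=> ht; apply: continuousB.
    apply: continuousD.
      apply: continuous_sum => j; apply: continuousB; last exact: cst_continuous.
      apply: continuousM; last exact: cst_continuous.
      by apply: continuousD; [by []|exact: cst_continuous].
    apply: continuous_carg; last exact: weighted_cot_slit.
      by apply: continuousM;
        [exact: (continuous_sub_half a).1|exact: (continuous_half_sub b).1].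
    exact: continuous_weighted_cot.
  by apply: continuousD;
    [apply: continuous_sum => k; have [+ _ _] := AP k; exact|by []].
have [altb _] := andP hab.
have Ya : Y a < 0 by exact: weighted_cot_left.
have Yb : 0 < Y b by exact: weighted_cot_right.
have := polar_lift_const altb cG Gc.
rewrite /G /K arc_bump_left arc_bump_right (carg_imag_pos Yb) (carg_imag_neg Ya).
have Mab : M b - M a = N%:R * ((b - a) / 2).
  rewrite /M -sumrB (eq_bigr (fun=> (b - a) / 2)) => [|j _]; last by field.
  by rewrite sumr_const card_ord mulr_natl.
have -> : \sum_k A k b = \sum_k A k a + \sum_k Theta a b (tnth w k).
  by rewrite -big_split /=; apply: eq_bigr => k _; have [_ _ <-] := AP k; ring.
by rewrite natrB // mulrBl; lra.
Qed.
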